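(* The category of ordered abelian groups equipped with an automorphism has the Amalgamation Property, and so do the category of models of $\mathbb R\mathsf{-OVSA}$ and the category of models of $\mathbb Q\mathsf{-OVSA}$ (in each case, with arrows the embeddings in the appropriate language).
   Context: An ordered abelian group is an abelian group $(A,+)$ with a linear order $<$ such that $x<y$ implies $x+z<y+z$. An ordered abelian group with an automorphism is a pair $(A,\sigma_A)$ where $A$ is an ordered abelian group and $\sigma_A$ is an order-preserving group automorphism of $A$; embeddings $(A,\sigma_A)\to(B,\sigma_B)$ are strictly increasing group homomorphisms $f\colon A\to B$ with $f\circ\sigma_A=\sigma_B\circ f$. For an ordered field $R\in\{\mathbb Q,\mathbb R\}$, an ordered $R$-vector space is an ordered abelian group which is also an $R$-vector space in such a way that multiplication by positive scalars preserves signs. $R\mathsf{-OVSA}$ is the theory of (possibly trivial) ordered $R$-vector spaces equipped with an $R$-linear strictly increasing bijection $\sigma$ and its inverse, in the language $L_{R,\sigma}=\{+,0,-,<\}\cup\{\lambda\cdot-:\lambda\in R\}\cup\{\sigma,\sigma^{-1}\}$. The $L_{R,\sigma}$-embeddings between models are the $R$-linear strictly increasing maps commuting with $\sigma$. A category has the Amalgamation Property if for every pair of arrows $f\colon A\to B$, $g\colon A\to C$ there are an object $D$ and arrows $f'\colon B\to D$, $g'\colon C\to D$ with $f'\circ f=g'\circ g$. *)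

(* Defs.v *)
From HB Require Import structures.
From mathcomp Require Import all_boot all_order all_algebra.
From mathcomp Require Import boolp reals.

Set Implicit Arguments.
Unset Strict Implicit.
Unset Printing Implicit Defensive.

Import Order.TTheory GRing.Theory Num.Theory.
Local Open Scope ring_scope.

Record category := Category {
  cat_obj :> Type;
  arr : cat_obj -> cat_obj -> Type;
  arr_id : forall A, arr A A;
  arr_comp : forall A B C, arr B C -> arr A B -> arr A C;
  arr_comp1m : forall A B (f : arr A B), arr_comp (arr_id B) f = f;
  arr_compm1 : forall A B (f : arr A B), arr_comp f (arr_id A) = f;
  arr_compA : forall A B C D (h : arr C D) (g : arr B C) (f : arr A B),
    arr_comp h (arr_comp g f) = arr_comp (arr_comp h g) f }.

Definition amalgamation_property (C : category) : Prop :=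
  forall (X Y Z : C) (f : arr X Y) (g : arr X Z),
  exists (W : C) (f' : arr Y W) (g' : arr Z W), arr_comp f' f = arr_comp g' g.

Section ConcreteCategory.
Variables (O : Type) (car : O -> Type).
Variable P : forall A B : O, (car A -> car B) -> Prop.
Hypothesis P_id : forall A, P (@id (car A)).
Hypothesis P_comp : forall (A B C : O) (g : car B -> car C) (f : car A -> car B),
  P g -> P f -> P (g \o f).

Definition chom A B := {f : car A -> car B | P f}.

Lemma chom_eq A B (f g : chom A B) : sval f =1 sval g -> f = g.
Proof.
move: f g => [f Pf] [g Pg] /= /funext fg; rewrite {}fg in Pf *.
by congr exist; exact: Prop_irrelevance.
Qed.

Definition cid A : chom A A := exist _ _ (P_id A).
Definition ccomp A B C (g : chom B C) (f : chom A B) : chom A C :=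
  exist _ _ (P_comp (svalP g) (svalP f)).

Lemma ccomp1m A B (f : chom A B) : ccomp (cid B) f = f.
Proof. exact: chom_eq. Qed.
Lemma ccompm1 A B (f : chom A B) : ccomp f (cid A) = f.
Proof. exact: chom_eq. Qed.
Lemma ccompA A B C D (h : chom C D) (g : chom B C) (f : chom A B) :
  ccomp h (ccomp g f) = ccomp (ccomp h g) f.
Proof. exact: chom_eq. Qed.

Definition concrete_category : category :=
  Category ccomp1m ccompm1 ccompA.

End ConcreteCategory.

(* As every zmodType, an ordered abelian group carries a choice operator and
   boolean comparisons; classically every type and every relation has these. *)
HB.mixin Record isOrderedZmodule V of Num.POrderedZmodule V := {
  leo_total : total (<=%R : rel V);
  ltoD2r : forall x y z : V, x < y -> x + z < y + z }.

#[short(type="orderedZmodType")]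
HB.structure Definition OrderedZmodule :=
  {V of Num.POrderedZmodule V & isOrderedZmodule V}.

HB.mixin Record isPositiveScale (K : realFieldType) V
    of GRing.Lmodule K V & OrderedZmodule V := {
  scaleo_gt0 : forall (k : K) (x : V), 0 < k -> 0 < x -> 0 < k *: x }.

#[short(type="orderedVectType")]
HB.structure Definition OrderedVect (K : realFieldType) :=
  {V of GRing.Lmodule K V & OrderedZmodule V & isPositiveScale K V}.

Record oag_aut := OagAut {
  oag_sort :> orderedZmodType;
  oag_sigma : oag_sort -> oag_sort;
  oag_sigmaB : zmod_morphism oag_sigma;
  oag_sigma_bij : bijective oag_sigma;
  oag_sigma_lt : {homo oag_sigma : x y / x < y} }.

Definition oag_embedding (A B : oag_aut) (f : A -> B) : Prop :=
  [/\ zmod_morphism f, {homo f : x y / x < y}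
    & f \o @oag_sigma A =1 @oag_sigma B \o f].

Lemma oag_embedding_id (A : oag_aut) : oag_embedding (@id A).
Proof. by split. Qed.

Lemma oag_embedding_comp (A B C : oag_aut) (g : B -> C) (f : A -> B) :
  oag_embedding g -> oag_embedding f -> oag_embedding (g \o f).
Proof.
move=> [gB glt gs] [fB flt fs]; split.
- by move=> x y; rewrite /= fB gB.
- by move=> x y /flt/glt.
- by move=> x /=; have /= -> := fs x; exact: gs.
Qed.

Definition OAGAut : category :=
  concrete_category oag_embedding_id oag_embedding_comp.

Record ovsa_model (K : realFieldType) := OvsaModel {
  ovsa_sort :> orderedVectType K;
  ovsa_sigma : ovsa_sort -> ovsa_sort;
  ovsa_sigmaV : ovsa_sort -> ovsa_sort;
  ovsa_sigmaK : cancel ovsa_sigma ovsa_sigmaV;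
  ovsa_sigmaVK : cancel ovsa_sigmaV ovsa_sigma;
  ovsa_sigma_linear : linear ovsa_sigma;
  ovsa_sigma_lt : {homo ovsa_sigma : x y / x < y} }.

Definition ovsa_embedding (K : realFieldType) (A B : ovsa_model K)
    (f : A -> B) : Prop :=
  [/\ linear f, {homo f : x y / x < y}
    & f \o @ovsa_sigma K A =1 @ovsa_sigma K B \o f].

(* The symbol for the inverse automorphism is then preserved as well. *)
Lemma ovsa_embedding_sigmaV (K : realFieldType) (A B : ovsa_model K)
    (f : A -> B) : ovsa_embedding f ->
  f \o @ovsa_sigmaV K A =1 @ovsa_sigmaV K B \o f.
Proof.
move=> [_ _ fs] x /=; apply: (can_inj (@ovsa_sigmaK K B)).
by rewrite ovsa_sigmaVK; have /= <- := fs (ovsa_sigmaV x); rewrite ovsa_sigmaVK.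
Qed.

Lemma ovsa_embedding_id (K : realFieldType) (A : ovsa_model K) :
  ovsa_embedding (@id A).
Proof. by split. Qed.

Lemma ovsa_embedding_comp (K : realFieldType) (A B C : ovsa_model K)
    (g : B -> C) (f : A -> B) :
  ovsa_embedding g -> ovsa_embedding f -> ovsa_embedding (g \o f).
Proof.
move=> [gl glt gs] [fl flt fs]; split.
- by move=> a x y; rewrite /= fl gl.
- by move=> x y /flt/glt.
- by move=> x /=; have /= -> := fs x; exact: gs.
Qed.

Definition OVSA (K : realFieldType) : category :=
  concrete_category (@ovsa_embedding_id K) (@ovsa_embedding_comp K).

(* Main.v *)
Require Import Defs.
From HB Require Import structures.
From mathcomp Require Import all_boot all_order all_algebra reals.
From mathcomp Require Import boolp classical_sets ring_quotient.

(** Let [f : A -> B] and [g : A -> C] be embeddings.  The amalgam is a quotient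
of [B * C]: a total order on a quotient group is the same thing as a total
cone [Q] (a subset closed under addition such that [x] or [- x] always lies in
[Q]), the quotient being taken by [Q] intersected with [- Q].  The cone has to
be stable under the automorphism and to contain

      P = { (b, c) | f a <= b and - g a <= c for some a in A },

the positive elements that [B] and [C] force upon the pushout.  Positive
elements of [B] and [C] stay strictly positive in the quotient as soon as [Q]
contains the opposite of an element of [P] only when [P] already does.  Indeed
[P] meets [- P] exactly in the elements [(f a, - g a)]
([pushout_cone_lineality]), and those are what must be killed to make the
square commute.

Such a [Q] exists by Zorn's lemma ([total_cone_extension]); the point is that a
maximal stable cone with this property is total.  If neither [x] nor [- x]
can be added to [Q], there are [u] and [v] in [P], with opposites outside [P],
such that [- u = q + e x] and [- v = r - d x], where [q] and [r] are in [Q] and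
[e] and [d] are sums of iterates of the automorphism and its inverse.  Since
[d] and [e] commute, applying [d] to the first equality, [e] to the second,
and adding, eliminates [x]:

      - (d u + e v) = d q + e r is in Q.

Hence [- (d u + e v)], then [- d u], and finally [- u] are in [P]: the last step
holds because a nonzero sum of strictly increasing maps cannot send into [- P]
an element of [P] that is not there already.  This is absurd.

The argument only uses a commuting family of strictly increasing additive maps.
For ordered groups it is [sigma] and its inverse; for ordered vector spaces
the multiplications by positive scalars are added to the family, so that
the quotient by [Q] is again an ordered vector space. *)

Set Implicit Arguments.
Unset Strict Implicit.
Unset Printing Implicit Defensive.

Import Order.TTheory GRing.Theory Num.Theory.
Local Open Scope ring_scope.
Local Open Scope classical_set_scope.
Local Open Scope quotient_scope.

(** * Additive maps and ordered groups *)

Section Additive.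
Variables (U V : zmodType) (f : U -> V).
Hypothesis fB : zmod_morphism f.

Lemma zmod_morphism0 : f 0 = 0.
Proof. by rewrite -[in LHS](subrr 0) fB subrr. Qed.

Lemma zmod_morphismN x : f (- x) = - f x.
Proof. by rewrite -sub0r fB zmod_morphism0 sub0r. Qed.

Lemma zmod_morphismD x y : f (x + y) = f x + f y.
Proof. by rewrite -[in LHS](opprK y) fB zmod_morphismN opprK. Qed.

End Additive.

Section OrderedZmoduleTheory.
Variable V : orderedZmodType.
Implicit Types x y z : V.

Lemma leo_add2r z x y : x <= y -> x + z <= y + z.
Proof.
by rewrite le_eqVlt => /predU1P[->//|xy]; apply/ltW/ltoD2r.
Qed.

Lemma leoD x y z t : x <= y -> z <= t -> x + z <= y + t.
Proof.
move=> xy zt; apply: (le_trans (leo_add2r z xy)).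
by rewrite ![y + _]addrC leo_add2r.
Qed.

Lemma leo_opp x y : x <= y -> - y <= - x.
Proof.
by move=> /(leo_add2r (- x - y)); rewrite addrA subrr sub0r addrC subrK.
Qed.

Lemma lto_subr_gt0 x y : x < y -> 0 < y - x.
Proof. by move=> xy; rewrite -(subrr x); exact: ltoD2r. Qed.

End OrderedZmoduleTheory.

Section StrictlyIncreasing.
Variables (A B : orderedZmodType) (f : A -> B).
Hypothesis flt : {homo f : x y / x < y}.

Lemma homo_lt_le x y : x <= y -> f x <= f y.
Proof. by rewrite le_eqVlt => /predU1P[->//|/flt/ltW]. Qed.

Lemma homo_lt_reflect_le x y : f x <= f y -> x <= y.
Proof.
by case/orP: (leo_total x y) => //; rewrite le_eqVlt => /predU1P[->//|/flt/lt_geF ->].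
Qed.

Lemma homo_lt_inj : injective f.
Proof. by move=> x y e; apply/le_anti; rewrite !homo_lt_reflect_le // e. Qed.

End StrictlyIncreasing.

(** * Extending a stable cone to a stable total cone *)

Definition stable (U : Type) (Q : U -> Prop) (h : U -> U) :=
  forall x, Q x -> Q (h x).

Record total_cone (U : zmodType) := TotalCone {
  cone_set :> U -> Prop;
  coneD : forall x y, cone_set x -> cone_set y -> cone_set (x + y);
  cone_total : forall x, cone_set x \/ cone_set (- x) }.

Section TotalConeExtension.
Variables (U : zmodType) (I : Type) (op : I -> U -> U).
Hypothesis opB : forall i, zmod_morphism (op i).
Hypothesis opC : forall i j x, op i (op j x) = op j (op i x).

(** The nonzero elements of the semiring of operators generated by the family;
    leaving out the zero operator is what makes [combination_reflectN] true. *)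
Inductive combination : (U -> U) -> Prop :=
| CombId : combination id
| CombOp i e of combination e : combination (op i \o e)
| CombAdd e e' of combination e & combination e' : combination (e \+ e').

Lemma combinationB e : combination e -> zmod_morphism e.
Proof.
elim=> {e} [//|i e _ eB x y /=|e e' _ eB _ e'B x y /=].
- by rewrite eB opB.
- by rewrite eB e'B opprD addrACA.
Qed.

(** The elimination of [x] in [total_cone_extension] rests on this; it fails for
    a family that does not commute. *)
Lemma combinationC e e' x : combination e -> combination e' ->
  e (e' x) = e' (e x).
Proof.
move=> he he'; elim: he' x => {e'} [//|i e' _ IH x /=|e' e'' _ IH _ IH' x /=].
- rewrite -IH; elim: he (e' x) => {e IH} [//|j e _ IH|e e2 _ IH _ IH'] y /=.
  + by rewrite IH opC.
  + by rewrite IH IH' (zmod_morphismD (opB i)).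
- by rewrite (zmod_morphismD (combinationB he)) IH IH'.
Qed.

Lemma combination_stable (Q : set U) e :
  (forall x y, Q x -> Q y -> Q (x + y)) -> (forall i, stable Q (op i)) ->
  combination e -> stable Q e.
Proof.
move=> QD Qop; elim=> {e} [//|i e _ IH x Qx /=|e e' _ IH _ IH' x Qx /=].
- exact/Qop/IH.
- exact: QD (IH _ Qx) (IH' _ Qx).
Qed.

Variable P : set U.
Hypothesis P0 : P 0.
Hypothesis PD : forall x y, P x -> P y -> P (x + y).
Hypothesis Pop : forall i, stable P (op i).
Hypothesis PopN : forall i x, P x -> P (- op i x) -> P (- x).

(** A sum [e x + e' x] of elements of [P] can be in [- P] only if each term is:
    [- e x] is [- (e x + e' x)] plus the element [e' x] of [P]. *)
Lemma combination_reflectN e x : combination e -> P x -> P (- e x) -> P (- x).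
Proof.
move=> he; elim: he x => {e} [//|i e he IH x Px /=|e e' he IH he' _ x Px /=].
- move=> PN; apply: (IH _ Px); apply: PopN PN.
  exact: (combination_stable PD Pop he Px).
- move=> PN; apply: IH => //; rewrite -[- e x](addrK (- e' x)) opprK -opprD.
  by apply: PD => //; exact: (combination_stable PD Pop he' Px).
Qed.

(** The last condition says that passing from [P] to [Q] makes no further
    element of [P] vanish in the quotient. *)
Definition admissible (Q : set U) :=
  [/\ P `<=` Q, forall x y, Q x -> Q y -> Q (x + y),
      forall i, stable Q (op i) & forall x, P x -> Q (- x) -> P (- x)].

Definition adjoin (Q : set U) x :=
  Q `|` [set y | exists q e, [/\ Q q, combination e & y = q + e x]].

(** The set [adjoin Q x] always satisfies the closure conditions, so the only
    obstruction to its being admissible is a new opposite of an element of [P];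
    it is not in [Q], hence has the form [q + e x]. *)
Lemma adjoinNadmissible Q x : admissible Q -> ~ admissible (adjoin Q x) ->
  exists u q e, [/\ P u, ~ P (- u), Q q, combination e & - u = q + e x].
Proof.
move=> [PQ QD Qop QN] nadm; apply: contrapT => H; apply: nadm; split.
- by move=> y /PQ Qy; left.
- move=> y z [Qy|[q [e [Qq he ->]]]] [Qz|[q' [e' [Qq' he' ->]]]].
  + by left; exact: QD.
  + by right; exists (y + q'), e'; split; rewrite ?addrA //; exact: QD.
  + by right; exists (q + z), e; split; rewrite 1?addrAC //; exact: QD.
  + right; exists (q + q'), (e \+ e'); split; rewrite 1?addrACA //.
      exact: QD.
    exact: CombAdd.
- move=> i y [Qy|[q [e [Qq he ->]]]]; first by left; exact: Qop.
  right; exists (op i q), (op i \o e); split; [exact: Qop|exact: CombOp|].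
  by rewrite (zmod_morphismD (opB i)).
- move=> u Pu [/(QN _ Pu)//|[q [e [Qq he eu]]]]; apply: contrapT => nPu.
  by apply: H; exists u, q, e.
Qed.

Lemma admissible_bigcup (F : set (set U)) :
  F `<=` admissible -> total_on F subset -> F !=set0 ->
  admissible (\bigcup_(X in F) X).
Proof.
move=> Fadm Ftot [X0 FX0]; split.
- by move=> x Px; exists X0 => //; have [+ _ _ _] := Fadm _ FX0; apply.
- move=> x y [X FX Xx] [Y FY Yy].
  have [XY|YX] := Ftot _ _ FX FY.
  + by exists Y => //; have [_ + _ _] := Fadm _ FY; apply=> //; exact: XY.
  + by exists X => //; have [_ + _ _] := Fadm _ FX; apply=> //; exact: YX.
- by move=> i x [X FX Xx]; exists X => //; have [_ _ + _] := Fadm _ FX; apply.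
- by move=> x Px [X FX Xx]; have [_ _ _ +] := Fadm _ FX; apply.
Qed.

Lemma maximal_admissible_exists :
  exists2 Q, admissible Q & forall Q', Q `<=` Q' -> admissible Q' -> Q' `<=` Q.
Proof.
have Padm : admissible P by split.
have [|Q [[Q0|Qadm] Qmax]] := @Zorn_bigcup U [set X | X = set0 \/ admissible X].
- (* The union of the empty chain is empty, hence not admissible: this is why
     the empty set was added to the family. *)
  move=> F Fadm Ftot /=.
  have [[X FX XP]|H] := pselect (exists2 X, F X & admissible X); last first.
    left; rewrite -subset0 => x [X FX Xx].
    by have [X0|Xadm] := Fadm _ FX; [rewrite -X0|apply: H; exists X].
  right; rewrite (_ : \bigcup_(_ in F) _ = \bigcup_(Y in F `&` admissible) Y).
    apply: admissible_bigcup; last by exists X.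
      by move=> Y [].
    by move=> Y Z [FY _] [FZ _]; exact: Ftot.
  apply/seteqP; split=> x [Y FY Yx]; last by exists Y => //; case: FY.
  by exists Y => //; split=> //; case: (Fadm _ FY) => // Y0; rewrite Y0 in Yx.
- case: (Qmax P); last by right.
  by rewrite Q0; split=> // /(_ 0 P0).
- exists Q => // Q' QQ' Q'adm; apply: contrapT => nQ.
  by apply: (Qmax Q'); [split|right].
Qed.

(** Each obstruction to adding [x] or [- x] is an equation of degree one in [x]
    over the commutative semiring of combinations; cross-multiplying cancels
    [x] and leaves an obstruction inside [Q]. *)
Theorem total_cone_extension : exists Q : total_cone U,
  [/\ forall x, P x -> Q x, forall i, stable Q (op i)
    & forall x, P x -> Q (- x) -> P (- x)].
Proof.
have [Q Qadm Qmax] := maximal_admissible_exists.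
have [PQ QD Qop QN] := Qadm.
have Qtot x : Q x \/ Q (- x).
  have adj y : ~ Q y -> ~ admissible (adjoin Q y).
    move=> nQy adm; apply/nQy/(Qmax _ _ adm) => [z Qz|]; first by left.
    by right; exists 0, id; split; rewrite ?add0r; [exact: PQ|exact: CombId|].
  apply: contrapT => /not_orP[/adj nx /adj nNx].
  have [u [q [e [Pu nPu Qq he eu]]]] := adjoinNadmissible Qadm nx.
  have [v [r [d [Pv nPv Qr hd ev]]]] := adjoinNadmissible Qadm nNx.
  pose w := d u + e v.
  have Pst e0 := @combination_stable P e0 PD Pop.
  have Qst e0 := @combination_stable Q e0 QD Qop.
  have Pw : P w by apply: PD; [exact: Pst _ hd _ Pu|exact: Pst _ he _ Pv].
  have dN := zmod_morphismN (combinationB hd).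
  have eN := zmod_morphismN (combinationB he).
  have QNw : Q (- w).
    (* [- w] is [d q + d (e x) + (e r - e (d x))] *)
    rewrite opprD -dN -eN eu ev (zmod_morphismD (combinationB hd)).
    rewrite (zmod_morphismD (combinationB he)) dN eN (combinationC _ hd he).
    rewrite addrACA subrr addr0.
    by apply: QD; [exact: Qst _ hd _ Qq|exact: Qst _ he _ Qr].
  apply: nPu; apply: (combination_reflectN hd Pu).
  rewrite -[- d u](addrK (- e v)) opprK -opprD.
  by apply: PD; [exact: QN|exact: Pst _ he _ Pv].
by exists (TotalCone QD Qtot).
Qed.

End TotalConeExtension.

(** * The ordered group attached to a total cone *)

Section ConeQuotient.
Variables (U : zmodType) (Q : total_cone U).

Lemma cone0 : Q 0.
Proof. by have := cone_total Q 0; rewrite oppr0 => -[]. Qed.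

Definition cone_kernel (x : U) : bool := `[< Q x /\ Q (- x) >].

Lemma cone_kernel_zmod_closed : zmod_closed cone_kernel.
Proof.
split=> [|x y /asboolP[Qx QNx] /asboolP[Qy QNy]]; apply/asboolP.
  by rewrite oppr0; split; exact: cone0.
by rewrite opprB; split; rewrite 1?[y - x]addrC; exact: coneD.
Qed.

HB.instance Definition _ :=
  GRing.isZmodClosed.Build U cone_kernel cone_kernel_zmod_closed.

Definition cone_lineality : zmodClosed U := GRing.ZmodClosed.clone U cone_kernel _.

Definition cone_quot : Type := Quotient.quot cone_lineality.

HB.instance Definition _ := EqQuotient.on cone_quot.
HB.instance Definition _ := GRing.Zmodule.on cone_quot.

Definition cone_pi (x : U) : cone_quot := \pi_cone_quot x.

Lemma cone_piB : zmod_morphism cone_pi.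
Proof. exact: (pi_is_zmod_morphism (Quotient.quot cone_lineality)). Qed.

Lemma cone_pi_repr (x : cone_quot) : cone_pi (repr x) = x.
Proof. exact: reprK. Qed.

Lemma cone_piP x y : cone_pi x = cone_pi y <-> Q (x - y) /\ Q (y - x).
Proof.
rewrite -[y - x]opprB.
have := Quotient.idealrBE cone_lineality x y.
rewrite -topredE /= => e; split=> [/eqP|H].
  by rewrite -e => /asboolP.
by apply/eqP; rewrite -e; apply/asboolP.
Qed.

Definition cone_le (x y : cone_quot) := `[< Q (repr y - repr x) >].

Lemma cone_le_pi x y : cone_le (cone_pi x) (cone_pi y) = `[< Q (y - x) >].
Proof.
have /cone_piP[xr rx] := cone_pi_repr (cone_pi x).
have /cone_piP[yr ry] := cone_pi_repr (cone_pi y).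
apply: asbool_equiv_eq; split=> H.
  by have := coneD (coneD ry H) xr; rewrite !addrA !subrK.
by have := coneD (coneD yr H) rx; rewrite !addrA !subrK.
Qed.

Lemma cone_le_refl : reflexive cone_le.
Proof. by move=> x; apply/asboolP; rewrite subrr; exact: cone0. Qed.

Lemma cone_le_anti : antisymmetric cone_le.
Proof.
move=> x y /andP[/asboolP xy /asboolP yx].
by rewrite -[x]cone_pi_repr -[y]cone_pi_repr; apply/cone_piP.
Qed.

Lemma cone_le_trans : transitive cone_le.
Proof.
move=> y x z /asboolP xy /asboolP yz; apply/asboolP.
by have := coneD yz xy; rewrite addrA subrK.
Qed.

HB.instance Definition _ := Order.Le_isPOrder.Build ring_display cone_quot
  cone_le_refl cone_le_anti cone_le_trans.

Lemma le_cone_pi x y : (cone_pi x <= cone_pi y) = `[< Q (y - x) >].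
Proof. exact: cone_le_pi. Qed.

Lemma cone_quot_total : total (<=%R : rel cone_quot).
Proof.
move=> x y; apply/orP; rewrite -[x]cone_pi_repr -[y]cone_pi_repr !le_cone_pi.
have := cone_total Q (repr y - repr x); rewrite opprB.
by case=> H; [left|right]; apply/asboolP.
Qed.

Lemma cone_quot_ltD2r (x y z : cone_quot) : x < y -> x + z < y + z.
Proof.
rewrite !lt_neqAle (inj_eq (addIr z)) => /andP[-> /=].
rewrite -[x]cone_pi_repr -[y]cone_pi_repr -[z]cone_pi_repr.
by rewrite -!(zmod_morphismD cone_piB) !le_cone_pi opprD addrACA subrr addr0.
Qed.

HB.instance Definition _ :=
  isOrderedZmodule.Build cone_quot cone_quot_total cone_quot_ltD2r.

Definition cone_quot_map (h : U -> U) (x : cone_quot) := cone_pi (h (repr x)).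

Section Map.
Variable h : U -> U.
Hypothesis hB : zmod_morphism h.
Hypothesis hQ : stable Q h.

Lemma cone_quot_map_pi x : cone_quot_map h (cone_pi x) = cone_pi (h x).
Proof.
have /cone_piP[xr rx] := cone_pi_repr (cone_pi x).
by apply/cone_piP; rewrite -!hB; split; exact: hQ.
Qed.

Lemma cone_quot_mapB : zmod_morphism (cone_quot_map h).
Proof.
move=> x y; rewrite -[x]cone_pi_repr -[y]cone_pi_repr -cone_piB.
by rewrite !cone_quot_map_pi hB cone_piB.
Qed.

Lemma cone_quot_map_le : {homo cone_quot_map h : x y / x <= y}.
Proof.
move=> x y; rewrite -[x]cone_pi_repr -[y]cone_pi_repr !cone_quot_map_pi.
by rewrite !le_cone_pi => /asboolP/hQ; rewrite hB => H; apply/asboolP.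
Qed.

Lemma cone_quot_map_lt : injective (cone_quot_map h) ->
  {homo cone_quot_map h : x y / x < y}.
Proof.
move=> hI x y; rewrite !lt_neqAle (inj_eq hI) => /andP[-> /=].
exact: cone_quot_map_le.
Qed.

End Map.

Lemma cone_quot_mapK (h k : U -> U) :
  zmod_morphism h -> stable Q h -> zmod_morphism k -> stable Q k ->
  cancel h k -> cancel (cone_quot_map h) (cone_quot_map k).
Proof.
move=> hB hQ kB kQ hK x; rewrite -[x]cone_pi_repr.
by rewrite !cone_quot_map_pi // hK.
Qed.

End ConeQuotient.

(** * The ordered vector space attached to a total cone *)

Record total_vcone (K : realFieldType) (U : lmodType K) := TotalVCone {
  vcone_cone :> total_cone U;
  vcone_scale : forall k : K, 0 < k -> stable vcone_cone ( *:%R k) }.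

Section VConeQuotient.
Variables (K : realFieldType) (U : lmodType K) (Q : total_vcone U).

(** A separate name carries the vector space structure, which depends on the
    stability of the cone under positive scalars. *)
Definition vcone_quot : Type := cone_quot Q.

HB.instance Definition _ := OrderedZmodule.on vcone_quot.

Definition vcone_scaleq (k : K) : vcone_quot -> vcone_quot :=
  cone_quot_map ( *:%R k).

Lemma vcone_scaleq_pi k x : vcone_scaleq k (cone_pi Q x) = cone_pi Q (k *: x).
Proof.
have /cone_piP[xr rx] := cone_pi_repr (cone_pi Q x).
apply/cone_piP; rewrite -!scalerBr; have [k0|k0|->] := ltrgtP k 0.
- (* The kernel of the cone is a subgroup, so it is also stable under
     negative scalars. *)
  have kN a b : k *: (a - b) = - k *: (b - a) by rewrite scaleNr -scalerN opprB.
  by rewrite !kN; split; apply: vcone_scale; rewrite ?oppr_gt0.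
- by split; exact: vcone_scale.
- by rewrite !scale0r; split; exact: cone0.
Qed.

Lemma vcone_scaleqA a b v :
  vcone_scaleq a (vcone_scaleq b v) = vcone_scaleq (a * b) v.
Proof. by rewrite -[v]cone_pi_repr !vcone_scaleq_pi scalerA. Qed.

Lemma vcone_scaleq1 : left_id 1 vcone_scaleq.
Proof. by move=> v; rewrite -[v]cone_pi_repr vcone_scaleq_pi scale1r. Qed.

Lemma vcone_scaleqDr : right_distributive vcone_scaleq +%R.
Proof.
move=> a u v; rewrite -[u]cone_pi_repr -[v]cone_pi_repr.
by rewrite -(zmod_morphismD (@cone_piB _ Q)) !vcone_scaleq_pi scalerDr
  (zmod_morphismD (@cone_piB _ Q)).
Qed.

Lemma vcone_scaleqDl v : {morph vcone_scaleq^~ v : a b / a + b}.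
Proof.
move=> a b; rewrite /= -[v]cone_pi_repr !vcone_scaleq_pi scalerDl.
exact: (zmod_morphismD (@cone_piB _ Q)).
Qed.

HB.instance Definition _ := GRing.Zmodule_isLmodule.Build K vcone_quot
  vcone_scaleqA vcone_scaleq1 vcone_scaleqDr vcone_scaleqDl.

Lemma vcone_piZ k x : cone_pi Q (k *: x) = k *: (cone_pi Q x : vcone_quot).
Proof. by rewrite -vcone_scaleq_pi. Qed.

Lemma vcone_scale_gt0 (k : K) (x : vcone_quot) : 0 < k -> 0 < x -> 0 < k *: x.
Proof.
move=> k0; rewrite !lt_neqAle => /andP[x0 xge0]; apply/andP; split.
  by rewrite eq_sym scaler_eq0 negb_or gt_eqF // eq_sym.
have := cone_quot_map_le (scalerBr k) (@vcone_scale _ _ Q k k0) xge0.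
by rewrite -[X in X <= _]/(k *: (0 : vcone_quot)) scaler0.
Qed.

HB.instance Definition _ := isPositiveScale.Build K vcone_quot vcone_scale_gt0.

End VConeQuotient.

(** * The total cone on the product of two extensions *)

Section AmalgamCone.
Variables (A B C : orderedZmodType) (f : A -> B) (g : A -> C).
Hypotheses (fB : zmod_morphism f) (gB : zmod_morphism g).
Hypotheses (flt : {homo f : x y / x < y}) (glt : {homo g : x y / x < y}).

Definition pushout_cone : set (B * C) :=
  [set u | exists2 a, f a <= u.1 & - g a <= u.2].

Lemma pushout_cone0 : pushout_cone 0.
Proof.
by exists 0; rewrite ?(zmod_morphism0 fB) ?(zmod_morphism0 gB) ?oppr0; exact: lexx.
Qed.

Lemma pushout_coneD u v :
  pushout_cone u -> pushout_cone v -> pushout_cone (u + v).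
Proof.
move=> [a fa ga] [a' fa' ga']; exists (a + a').
  by rewrite (zmod_morphismD fB) leoD.
by rewrite (zmod_morphismD gB) opprD leoD.
Qed.

Lemma pushout_cone_antidiagonal a : pushout_cone (f a, - g a).
Proof. by exists a => /=. Qed.

(** If [a] witnesses [u] and [a'] witnesses [- u], then [f a <= f (- a')] and
    [g (- a') <= g a]; as [f] and [g] reflect the order, [a = - a'] and all
    inequalities are equalities. *)
Lemma pushout_cone_lineality u : pushout_cone u -> pushout_cone (- u) ->
  exists a, u = (f a, - g a).
Proof.
case: u => b c [a /= fa ga] [a' /= /leo_opp fa' /leo_opp ga'].
rewrite !opprK in fa' ga'.
have le1 : a <= - a'.
  apply: (homo_lt_reflect_le flt).
  by rewrite (zmod_morphismN fB); exact: le_trans fa fa'.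
have le2 : - a' <= a.
  apply: (homo_lt_reflect_le glt); rewrite (zmod_morphismN gB).
  by have /leo_opp := le_trans ga ga'; rewrite opprK.
have e : a = - a' by apply/le_anti/andP.
exists a; congr pair; apply/le_anti/andP; split => //.
- by rewrite [in X in _ <= X]e (zmod_morphismN fB).
- by rewrite [in X in _ <= X]e (zmod_morphismN gB) opprK.
Qed.

Lemma pushout_cone_gt0l b : 0 < b ->
  pushout_cone (b, 0) /\ ~ pushout_cone (- (b, 0)).
Proof.
move=> b0; have bP : pushout_cone (b, 0).
  exists 0; rewrite ?(zmod_morphism0 fB) ?(zmod_morphism0 gB) ?oppr0.
    exact: ltW.
  exact: lexx.
split=> // /(pushout_cone_lineality bP)[a [ba /esym/eqP]].
rewrite oppr_eq0 -(zmod_morphism0 gB) (inj_eq (homo_lt_inj glt)) => /eqP a0.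
by move: b0; rewrite ba a0 (zmod_morphism0 fB) ltxx.
Qed.

Lemma pushout_cone_gt0r c : 0 < c ->
  pushout_cone (0, c) /\ ~ pushout_cone (- (0, c)).
Proof.
move=> c0; have cP : pushout_cone (0, c).
  exists 0; rewrite ?(zmod_morphism0 fB) ?(zmod_morphism0 gB) ?oppr0.
    exact: lexx.
  exact: ltW.
split=> // /(pushout_cone_lineality cP)[a [/esym/eqP + ca]].
rewrite -(zmod_morphism0 fB) (inj_eq (homo_lt_inj flt)) => /eqP a0.
by move: c0; rewrite ca a0 (zmod_morphism0 gB) oppr0 ltxx.
Qed.

Variables (I : Type) (sA : I -> A -> A) (sB : I -> B -> B) (sC : I -> C -> C).
Hypotheses (sBB : forall i, zmod_morphism (sB i))
           (sCB : forall i, zmod_morphism (sC i)).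
Hypotheses (sBlt : forall i, {homo sB i : x y / x < y})
           (sClt : forall i, {homo sC i : x y / x < y}).
Hypotheses (sBC : forall i j x, sB i (sB j x) = sB j (sB i x))
           (sCC : forall i j x, sC i (sC j x) = sC j (sC i x)).
Hypotheses (sf : forall i x, f (sA i x) = sB i (f x))
           (sg : forall i x, g (sA i x) = sC i (g x)).

Definition pair_op i (u : B * C) : B * C := (sB i u.1, sC i u.2).

Lemma pair_opB i : zmod_morphism (pair_op i).
Proof. by move=> u v; rewrite /pair_op /= sBB sCB. Qed.

Lemma pushout_cone_stable i : stable pushout_cone (pair_op i).
Proof.
move=> u [a fa ga]; exists (sA i a) => /=.
  by rewrite sf; exact: (homo_lt_le (@sBlt i)).
by rewrite sg -(zmod_morphismN (@sCB i)); exact: (homo_lt_le (@sClt i)).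
Qed.

(** By [pushout_cone_lineality] the image of [u] is [(f a', - g a')]; comparing
    it with the image of a witness [a] of [u] gives [a' = sA i a], and then
    injectivity of [sB i] and [sC i] gives [u = (f a, - g a)]. *)
Lemma pushout_cone_reflectN i u :
  pushout_cone u -> pushout_cone (- pair_op i u) -> pushout_cone (- u).
Proof.
move=> Pu /(pushout_cone_lineality (@pushout_cone_stable i _ Pu))[a' [eB eC]].
case: Pu => a fa ga.
have le1 : sA i a <= a'.
  apply: (homo_lt_reflect_le flt).
  by rewrite sf -eB; exact: (homo_lt_le (@sBlt i)).
have le2 : a' <= sA i a.
  apply: (homo_lt_reflect_le glt).
  have /leo_opp := homo_lt_le (@sClt i) ga.
  by rewrite eC (zmod_morphismN (@sCB i)) !opprK sg.
have e : a' = sA i a by apply/le_anti/andP.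
move: eB; rewrite e sf => /(homo_lt_inj (@sBlt i)) u1.
move: eC; rewrite e sg -(zmod_morphismN (@sCB i)).
move=> /(homo_lt_inj (@sClt i)) u2.
exists (- a) => /=.
  by rewrite u1 (zmod_morphismN fB).
by rewrite u2 (zmod_morphismN gB).
Qed.

(** Strict positivity of the images of [B] and [C] in the quotient makes the two
    maps into it embeddings, and the elements [(f a, - g a)], whose opposites
    have the same form, vanish there. *)
Theorem amalgam_cone : exists Q : total_cone (B * C)%type,
  [/\ forall i, stable Q (pair_op i), forall a, Q (f a, - g a),
      forall b, 0 < b -> Q (b, 0) /\ ~ Q (- (b, 0))
    & forall c, 0 < c -> Q (0, c) /\ ~ Q (- (0, c))].
Proof.
have opC i j u : pair_op i (pair_op j u) = pair_op j (pair_op i u).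
  by rewrite /pair_op /= sBC sCC.
have [Q [PQ Qst QN]] := total_cone_extension pair_opB opC pushout_cone0
  pushout_coneD pushout_cone_stable pushout_cone_reflectN.
exists Q; split=> //.
- by move=> a; apply/PQ/pushout_cone_antidiagonal.
- by move=> b /pushout_cone_gt0l[Pb nPb]; split; [exact: PQ|move=> /(QN _ Pb)].
- by move=> c /pushout_cone_gt0r[Pc nPc]; split; [exact: PQ|move=> /(QN _ Pc)].
Qed.

End AmalgamCone.

(** * Embedding the two extensions in the quotient *)

Section ConeEmbedding.
Variables (U : zmodType) (Q : total_cone U) (B : orderedZmodType) (h : B -> U).
Hypothesis hB : zmod_morphism h.
Hypothesis h_gt0 : forall b, 0 < b -> Q (h b) /\ ~ Q (- h b).

Lemma cone_pi_compB : zmod_morphism (cone_pi Q \o h).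
Proof. by move=> x y /=; rewrite hB cone_piB. Qed.

Lemma cone_pi_comp_lt : {homo cone_pi Q \o h : x y / x < y}.
Proof.
move=> x y /lto_subr_gt0/h_gt0; rewrite hB => -[Qxy nQxy] /=.
rewrite lt_neqAle le_cone_pi; apply/andP; split; last exact/asboolP.
by apply/eqP => /cone_piP[H _]; apply: nQxy; rewrite opprB.
Qed.

End ConeEmbedding.

Section Injections.
Variables B C : zmodType.

Definition pair_inl (b : B) : B * C := (b, 0).
Definition pair_inr (c : C) : B * C := (0, c).

Lemma pair_inlB : zmod_morphism pair_inl.
Proof. by move=> x y; congr pair; rewrite /= subr0. Qed.

Lemma pair_inrB : zmod_morphism pair_inr.
Proof. by move=> x y; congr pair; rewrite /= subr0. Qed.

Lemma cone_pi_pushout (A : zmodType) (f : A -> B) (g : A -> C)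
    (Q : total_cone (B * C)%type) :
  zmod_morphism f -> zmod_morphism g -> (forall a, Q (f a, - g a)) ->
  cone_pi Q \o pair_inl \o f =1 cone_pi Q \o pair_inr \o g.
Proof.
move=> fB gB Qfg x; apply/cone_piP; split.
  rewrite (_ : _ - _ = (f x, - g x)) //.
  by congr pair; rewrite /= ?subr0 ?sub0r.
rewrite (_ : _ - _ = (f (- x), - g (- x))) //.
by congr pair; rewrite /= ?(zmod_morphismN fB) ?(zmod_morphismN gB)
  ?subr0 ?sub0r ?opprK.
Qed.

End Injections.

(** * Amalgamation of ordered groups with an automorphism *)

Definition automorphism_op (T : Type) (s t : T -> T) (b : bool) := if b then s else t.

Section InverseAutomorphism.
Variables (V : orderedZmodType) (s t : V -> V).
Hypotheses (sK : cancel s t) (tK : cancel t s).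
Hypotheses (sB : zmod_morphism s) (slt : {homo s : x y / x < y}).

Lemma inverse_zmod_morphism : zmod_morphism t.
Proof. by move=> x y; apply: (can_inj sK); rewrite sB !tK. Qed.

Lemma inverse_lt : {homo t : x y / x < y}.
Proof.
move=> x y; rewrite !lt_neqAle (can_eq tK) => /andP[-> xy] /=.
by apply: (homo_lt_reflect_le slt); rewrite !tK.
Qed.

Lemma automorphism_opB b : zmod_morphism (automorphism_op s t b).
Proof. by case: b; [exact: sB|exact: inverse_zmod_morphism]. Qed.

Lemma automorphism_op_lt b : {homo automorphism_op s t b : x y / x < y}.
Proof. by case: b; [exact: slt|exact: inverse_lt]. Qed.

Lemma automorphism_opC b c x : automorphism_op s t b (automorphism_op s t c x) =
  automorphism_op s t c (automorphism_op s t b x).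
Proof. by case: b c => -[] //=; rewrite sK tK. Qed.

End InverseAutomorphism.

Lemma automorphism_op_intertwine (U V : Type) (f : U -> V) s t s' t' b x :
  cancel t s -> cancel s' t' -> (forall y, f (s y) = s' (f y)) ->
  f (automorphism_op s t b x) = automorphism_op s' t' b (f x).
Proof. by case: b => //= tK s'K fs; rewrite -{2}(tK x) fs s'K. Qed.

Theorem OAGAut_amalgamation : amalgamation_property OAGAut.
Proof.
move=> A B C [f [fB flt fs]] [g [gB glt gs]].
have [sAV sAK sAVK] := oag_sigma_bij A.
have [sBV sBK sBVK] := oag_sigma_bij B.
have [sCV sCK sCVK] := oag_sigma_bij C.
have sBB := automorphism_opB sBK sBVK (@oag_sigmaB B).
have sCB := automorphism_opB sCK sCVK (@oag_sigmaB C).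
have sBlt := automorphism_op_lt sBVK (@oag_sigma_lt B).
have sClt := automorphism_op_lt sCVK (@oag_sigma_lt C).
have [Q [Qst Qfg QB QC]] := amalgam_cone fB gB flt glt sBB sCB sBlt sClt
  (automorphism_opC sBK sBVK) (automorphism_opC sCK sCVK)
  (fun b x => automorphism_op_intertwine b x sAVK sBK fs)
  (fun b x => automorphism_op_intertwine b x sAVK sCK gs).
have opB := pair_opB sBB sCB.
pose s := cone_quot_map (Q := Q)
  (pair_op (automorphism_op (@oag_sigma B) sBV)
           (automorphism_op (@oag_sigma C) sCV) true).
pose t := cone_quot_map (Q := Q)
  (pair_op (automorphism_op (@oag_sigma B) sBV)
           (automorphism_op (@oag_sigma C) sCV) false).
have sK : cancel s t.
  apply: cone_quot_mapK => // -[b c].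
  by rewrite /pair_op /= sBK sCK.
have tK : cancel t s.
  apply: cone_quot_mapK => // -[b c].
  by rewrite /pair_op /= sBVK sCVK.
have slt : {homo s : x y / x < y}.
  by apply: cone_quot_map_lt => //; exact: can_inj sK.
pose W := @OagAut (cone_quot Q) s (cone_quot_mapB (opB true) (Qst true))
  (Bijective sK tK) slt.
have f'P : @oag_embedding B W (cone_pi Q \o @pair_inl B C).
  split; first exact: cone_pi_compB (@pair_inlB B C).
    exact: cone_pi_comp_lt (@pair_inlB B C) QB.
  move=> b /=; rewrite /s cone_quot_map_pi //; congr (cone_pi Q (_, _)).
  by rewrite /= (zmod_morphism0 (@oag_sigmaB C)).
have g'P : @oag_embedding C W (cone_pi Q \o @pair_inr B C).
  split; first exact: cone_pi_compB (@pair_inrB B C).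
    exact: cone_pi_comp_lt (@pair_inrB B C) QC.
  move=> c /=; rewrite /s cone_quot_map_pi //; congr (cone_pi Q (_, _)).
  by rewrite /= (zmod_morphism0 (@oag_sigmaB B)).
exists W, (exist _ _ f'P), (exist _ _ g'P).
exact/chom_eq/(cone_pi_pushout fB gB Qfg).
Qed.

(** * Amalgamation of ordered vector spaces with an automorphism *)

Section OVSA.
Variable K : realFieldType.

Lemma linear_zmod_morphism (U W : lmodType K) (h : U -> W) :
  linear h -> zmod_morphism h.
Proof. by move=> hL x y; rewrite addrC -scaleN1r hL scaleN1r addrC. Qed.

Lemma linear_scalable (U W : lmodType K) (h : U -> W) : linear h -> scalable h.
Proof.
move=> hL k x; rewrite -[k *: x]addr0 hL.
by rewrite (zmod_morphism0 (linear_zmod_morphism hL)) addr0.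
Qed.

(** Putting the positive scalars next to the automorphism and its inverse makes
    the resulting cone closed under positive scaling. *)
Definition vect_op (V : lmodType K) (s t : V -> V) (i : bool + {k : K | 0 < k}) :=
  match i with
  | inl b => automorphism_op s t b
  | inr k => *:%R (sval k)
  end.

Section VectOp.
Variables (V : orderedVectType K) (s t : V -> V).
Hypotheses (sK : cancel s t) (tK : cancel t s).
Hypotheses (sL : linear s) (slt : {homo s : x y / x < y}).

Lemma vect_opB i : zmod_morphism (vect_op s t i).
Proof.
case: i => [b|k]; last exact: scalerBr.
exact: (automorphism_opB sK tK (linear_zmod_morphism sL)).
Qed.

Lemma vect_op_lt i : {homo vect_op s t i : x y / x < y}.
Proof.
case: i => [b|[k k0]] /=; first exact: automorphism_op_lt.
move=> x y /lto_subr_gt0 xy; have := scaleo_gt0 _ _ k0 xy.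
by rewrite scalerBr => /(ltoD2r _ _ (k *: x)); rewrite add0r subrK.
Qed.

Lemma automorphism_opZ b k x :
  automorphism_op s t b (k *: x) = k *: automorphism_op s t b x.
Proof.
case: b => /=; first exact: linear_scalable.
by apply: (can_inj sK); rewrite (linear_scalable sL) !tK.
Qed.

Lemma vect_opC i j x : vect_op s t i (vect_op s t j x) =
  vect_op s t j (vect_op s t i x).
Proof.
case: i j => [b|k] [c|l] /=; rewrite ?automorphism_opZ //.
  exact: automorphism_opC.
by rewrite !scalerA mulrC.
Qed.

End VectOp.

Lemma vect_op_intertwine (U V : lmodType K) (f : U -> V) s t s' t' i x :
  cancel t s -> cancel s' t' -> linear f -> (forall y, f (s y) = s' (f y)) ->
  f (vect_op s t i x) = vect_op s' t' i (f x).
Proof.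
move=> tK s'K fL fs; case: i => [b|k] /=; last exact: linear_scalable.
exact: automorphism_op_intertwine.
Qed.

Theorem OVSA_amalgamation : amalgamation_property (OVSA K).
Proof.
move=> A B C [f [fL flt fs]] [g [gL glt gs]].
have fB := linear_zmod_morphism fL.
have gB := linear_zmod_morphism gL.
have sBB := vect_opB (@ovsa_sigmaK _ B) (@ovsa_sigmaVK _ B)
  (@ovsa_sigma_linear _ B).
have sCB := vect_opB (@ovsa_sigmaK _ C) (@ovsa_sigmaVK _ C)
  (@ovsa_sigma_linear _ C).
have sBlt := vect_op_lt (@ovsa_sigmaVK _ B) (@ovsa_sigma_lt _ B).
have sClt := vect_op_lt (@ovsa_sigmaVK _ C) (@ovsa_sigma_lt _ C).
have [Q0 [Qst Qfg QB QC]] := amalgam_cone fB gB flt glt sBB sCB sBlt sClt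
  (vect_opC (@ovsa_sigmaK _ B) (@ovsa_sigmaVK _ B) (@ovsa_sigma_linear _ B))
  (vect_opC (@ovsa_sigmaK _ C) (@ovsa_sigmaVK _ C) (@ovsa_sigma_linear _ C))
  (fun i x => vect_op_intertwine i x (@ovsa_sigmaVK _ A) (@ovsa_sigmaK _ B) fL fs)
  (fun i x => vect_op_intertwine i x (@ovsa_sigmaVK _ A) (@ovsa_sigmaK _ C) gL gs).
have opB := pair_opB sBB sCB.
have Qscale (k : K) (k0 : 0 < k) : stable Q0 ( *:%R k).
  by move=> [b c]; exact: (Qst (inr (exist _ k k0))).
pose Q := TotalVCone Qscale.
pose op i := pair_op (vect_op (@ovsa_sigma _ B) (@ovsa_sigmaV _ B))
  (vect_op (@ovsa_sigma _ C) (@ovsa_sigmaV _ C)) i.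
pose s : vcone_quot Q -> vcone_quot Q := cone_quot_map (op (inl true)).
pose t : vcone_quot Q -> vcone_quot Q := cone_quot_map (op (inl false)).
have sK : cancel s t.
  apply: cone_quot_mapK => //; try exact: opB; try exact: Qst.
  by move=> [b c]; rewrite /op /pair_op /= !ovsa_sigmaK.
have tK : cancel t s.
  apply: cone_quot_mapK => //; try exact: opB; try exact: Qst.
  by move=> [b c]; rewrite /op /pair_op /= !ovsa_sigmaVK.
have s_pi x : s (cone_pi Q x) = cone_pi Q (op (inl true) x).
  by apply: cone_quot_map_pi; [exact: opB|exact: Qst].
have sL : linear s.
  move=> k x y; rewrite -[x]cone_pi_repr -[y]cone_pi_repr -vcone_piZ.
  rewrite -(zmod_morphismD (@cone_piB _ Q)) !s_pi -vcone_piZ.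
  rewrite -(zmod_morphismD (@cone_piB _ Q)); congr (cone_pi Q (_, _)).
    exact: ovsa_sigma_linear.
  exact: ovsa_sigma_linear.
have slt : {homo s : x y / x < y}.
  apply: cone_quot_map_lt; [exact: opB|exact: Qst|exact: can_inj sK].
pose W := OvsaModel sK tK sL slt.
have f'P : @ovsa_embedding _ B W (cone_pi Q \o @pair_inl B C).
  split.
  - move=> k x y /=; rewrite -vcone_piZ -(zmod_morphismD (@cone_piB _ Q)).
    by congr (cone_pi Q (_, _)); rewrite /= scaler0 addr0.
  - exact: cone_pi_comp_lt (@pair_inlB B C) QB.
  - move=> b /=; rewrite s_pi; congr (cone_pi Q (_, _)).
    exact/esym/(zmod_morphism0 (sCB (inl true))).
have g'P : @ovsa_embedding _ C W (cone_pi Q \o @pair_inr B C).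
  split.
  - move=> k x y /=; rewrite -vcone_piZ -(zmod_morphismD (@cone_piB _ Q)).
    by congr (cone_pi Q (_, _)); rewrite /= scaler0 addr0.
  - exact: cone_pi_comp_lt (@pair_inrB B C) QC.
  - move=> c /=; rewrite s_pi; congr (cone_pi Q (_, _)).
    exact/esym/(zmod_morphism0 (sBB (inl true))).
exists W, (exist _ _ f'P), (exist _ _ g'P).
exact/chom_eq/(cone_pi_pushout (Q := Q) fB gB Qfg).
Qed.

End OVSA.

Theorem theorem5p10 (R : realType) :
  [/\ amalgamation_property OAGAut,
      amalgamation_property (OVSA R)
    & amalgamation_property (OVSA rat)].
Proof.
by split; [exact: OAGAut_amalgamation|exact: OVSA_amalgamation..].
Qed.
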